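(* Let $\mathcal{G}$ be a compact metric graph. (1) Suppose $\widetilde{\mathcal{G}}$ is formed from $\mathcal{G}$ by cutting through a vertex. Then $\rho(\widetilde{\mathcal{G}})>\rho(\mathcal{G})$, unless $\widetilde{\mathcal{G}}=\mathcal{G}$ (i.e. the cut is trivial and the cut vertex is unchanged). (2) Suppose $\mathcal{H}\subset\mathcal{G}$ is a pendant subgraph, meaning there is a vertex $v$ of $\mathcal{G}$ with $\mathcal{H}\cap\overline{\mathcal{G}\setminus\mathcal{H}}=\{v\}$. Suppose $\widetilde{\mathcal{G}}$ is formed from $\mathcal{G}$ by replacing $\mathcal{H}$ with another compact metric graph $\widetilde{\mathcal{H}}$, attached at the single point $v$, so that $\widetilde{\mathcal{G}}\setminus\widetilde{\mathcal{H}}=\mathcal{G}\setminus\mathcal{H}$. Assume all of the following hold: (a) $|\mathcal{H}|=|\widetilde{\mathcal{H}}|$; (b) $\rho_{\widetilde{\mathcal{H}}}(v)\ge\rho_{\mathcal{H}}(v)$; (c) $\rho(\widetilde{\mathcal{H}})\ge\rho(\mathcal{H})$. Then $\rho(\widetilde{\mathcal{G}})\ge\rho(\mathcal{G})$. The inequality is strict if $\rho_{\widetilde{\mathcal{H}}}(v)>\rho_{\mathcal{H}}(v)$, or if $\rho(\widetilde{\mathcal{H}})>\rho(\mathcal{H})$.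
   Context: A compact metric graph is a connected graph with finitely many vertices and edges. Loops and multiple edges are allowed. Each edge is identified with an interval $(0,\ell_e)$ with $\ell_e>0$. The graph carries the shortest-path distance $\operatorname{dist}$ and Lebesgue measure on the edges, and its total length is $|\mathcal{G}|=\sum_e\ell_e$. The mean distance function is $\rho_{\mathcal{G}}(x)=\frac{1}{|\mathcal{G}|}\int_{\mathcal{G}}\operatorname{dist}_{\mathcal{G}}(x,y)\,\mathrm{d}y$. The mean distance is $\rho(\mathcal{G})=\frac{1}{|\mathcal{G}|}\int_{\mathcal{G}}\rho_{\mathcal{G}}(x)\,\mathrm{d}x$. For a subgraph $\mathcal{H}$, $\rho_{\mathcal{H}}$ and $\rho(\mathcal{H})$ are computed intrinsically in $\mathcal{H}$. Cutting through a vertex $v$ means the following: the set of edge ends incident to $v$ is partitioned into classes, and $v$ is replaced by one new vertex for each class, each new vertex being incident to the edge ends of its class. The edges and their lengths are unchanged, and the resulting graph $\widetilde{\mathcal{G}}$ is required to remain connected. *)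

(* Defs.v *)
From HB Require Import structures.
From mathcomp Require Import all_boot all_order all_algebra.
From mathcomp Require Import all_classical all_reals all_analysis.

Set Implicit Arguments.
Unset Strict Implicit.
Unset Printing Implicit Defensive.

Import Order.TTheory GRing.Theory Num.Theory.
Import numFieldNormedType.Exports.

Local Open Scope classical_set_scope.
Local Open Scope ring_scope.

(* The edge e is the interval (0, len e); the edge end (e, false) is the one at
   parameter 0 and (e, true) the one at parameter len e, so that a loop has two
   distinct ends at the same vertex.  Connectedness is not part of this record:
   a compact metric graph is a G : metric_graph R such that connected_graph G. *)
Record metric_graph (R : realType) := MetricGraph {
  vertex : finType;
  edge : finType;
  inc : edge * bool -> vertex;
  len : edge -> R;
  len_gt0 : forall e, 0 < len e }.

Arguments inc {R} m _.
Arguments len {R} m _.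

Section MetricGraphs.
Variables (R : realType) (G : metric_graph R).

Definition adjacent_vertices : rel (vertex G) := fun u w =>
  [exists e, exists b, (inc G (e, b) == u) && (inc G (e, ~~ b) == w)].

Definition connected_graph : bool :=
  (0 < #|vertex G|)%N && [forall u, forall w, connect adjacent_vertices u w].

Definition total_length : R := \sum_(e : edge G) len G e.

Definition graph_point : Type :=
  (vertex G + {p : edge G * R | 0 < p.2 < len G p.1})%type.

(* The point of the closed edge e at parameter t, for 0 <= t <= len e. *)
Definition edge_point (e : edge G) (t : R) : graph_point :=
  if insub (e, t) is Some p then inr p else inl (inc G (e, 0 < t)).

(* path_length x y L: some path from x to y, made of finitely many segments
   each lying in one closed edge, has length L. *)
Inductive path_length : graph_point -> graph_point -> R -> Prop :=
| path_nil x : path_length x x 0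
| path_cons (e : edge G) (s t : R) (y : graph_point) (L : R) :
    0 <= s <= len G e -> 0 <= t <= len G e ->
    path_length (edge_point e t) y L ->
    path_length (edge_point e s) y (`|s - t| + L).

Definition dist (x y : graph_point) : R := inf [set L | path_length x y L].

Definition metric_closure (A : set graph_point) : set graph_point :=
  [set x | forall eps : R, 0 < eps -> exists2 y, A y & dist x y < eps].

Definition graph_integral (f : graph_point -> R) : R :=
  \sum_(e : edge G)
    \int[@lebesgue_measure R]_(t in `]0, len G e[) f (edge_point e t).

(* When G has no edge, its total length is 0 and both mean distances are 0. *)
Definition mean_distance_fun (x : graph_point) : R :=
  total_length^-1 * graph_integral (dist x).

Definition mean_distance : R :=
  total_length^-1 * graph_integral mean_distance_fun.

End MetricGraphs.

Section Cut.
Variables (R : realType) (G : metric_graph R) (v : vertex G).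

Definition ends_at : {set edge G * bool} := [set x | inc G x == v].

Variables (P : {set {set edge G * bool}}).

Definition is_cut_vertex (z : vertex G + {set edge G * bool}) : bool :=
  match z with inl u => u != v | inr B => B \in P end.

Definition cut_end (x : edge G * bool) : vertex G + {set edge G * bool} :=
  if inc G x == v then inr (finset.pblock P x) else inl (inc G x).

Hypothesis partP : finset.partition P ends_at.

Lemma cut_endP x : is_cut_vertex (cut_end x).
Proof.
rewrite /cut_end; case: ifPn => //= xv.
by rewrite finset.pblock_mem // (finset.cover_partition partP) inE.
Qed.

(* The vertex v is replaced by one vertex for each class of the partition P of
   the edge ends at v. *)
Definition cut_graph : metric_graph R :=
  @MetricGraph R {z | is_cut_vertex z} (edge G)
    (fun x => Sub (cut_end x) (cut_endP x)) (len G) (@len_gt0 R G).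

End Cut.

Record subgraph (R : realType) (G : metric_graph R) := Subgraph {
  sub_vertex : {set vertex G};
  sub_edge : {set edge G};
  sub_inc : forall x, x.1 \in sub_edge -> inc G x \in sub_vertex }.

Section Subgraphs.
Variables (R : realType) (G : metric_graph R) (H : subgraph G).

Definition graph_of_subgraph : metric_graph R :=
  @MetricGraph R {u | u \in sub_vertex H} {e | e \in sub_edge H}
    (fun x => Sub (inc G (val x.1, x.2))
                  (@sub_inc R G H (val x.1, x.2) (valP x.1)))
    (fun e => len G (val e)) (fun e => len_gt0 (val e)).

Definition subgraph_points : set (graph_point G) :=
  [set x | match x with
           | inl u => u \in sub_vertex H
           | inr p => (val p).1 \in sub_edge H
           end].

Definition pendant_at (v : vertex G) : Prop :=
  subgraph_points `&` metric_closure (~` subgraph_points) = [set inl v].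

Variables (Ht : metric_graph R) (vt : vertex Ht).

(* If H is pendant at v, then an edge outside H can meet H only at v; the ends
   at v of these edges are reattached to the vertex vt of Ht. *)
Definition replace_end (x : edge G * bool) :
    {u | u \notin sub_vertex H} + vertex Ht :=
  if insub (inc G x) is Some u then inl u else inr vt.

Definition replace_subgraph : metric_graph R :=
  @MetricGraph R
    ({u | u \notin sub_vertex H} + vertex Ht)%type
    ({e | e \notin sub_edge H} + edge Ht)%type
    (fun x => match x.1 with
              | inl e => replace_end (val e, x.2)
              | inr e => inr (inc Ht (e, x.2))
              end)
    (fun e => match e with inl e => len G (val e) | inr e => len Ht e end)
    (fun e => match e with inl e => len_gt0 (val e) | inr e => len_gt0 e end).

End Subgraphs.

(* Main.v *)
(* The distance is the largest pseudometric D on the graph such that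
   D (edge_point e s) (edge_point e t) <= |s - t| on every closed edge e.

   Gluing the classes of the cut back together therefore does not increase any
   distance, and it strictly decreases the distance between points close to two
   ends that the cut separates.  As distances are continuous, the double integral
   strictly decreases.

   For a pendant subgraph H at v with complement K, a path between H and K passes
   through v, and collapsing either side onto v does not lengthen paths, so that
   |G|^2 rho(G) = |H|^2 rho(H) + 2 |K| |H| rho_H(v) + terms depending only on |H|
   and on K.  Both rho(H) and rho_H(v) appear here with nonnegative coefficients,
   which are positive as soon as H has an edge. *)
Require Import Defs.
From HB Require Import structures.
From mathcomp Require Import all_boot all_order all_algebra.
From mathcomp Require Import all_classical all_reals all_analysis.
From mathcomp Require Import ring lra.

Set Implicit Arguments.
Unset Strict Implicit.
Unset Printing Implicit Defensive.

Import Order.TTheory GRing.Theory Num.Theory.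
Import numFieldNormedType.Exports.
Local Open Scope ring_scope.

(** * Integrals of Lipschitz functions over an interval *)

Section LipschitzIntegrals.
Variable R : realType.
Implicit Types (l k : R) (f g : R -> R).

Definition interval_integral l f : R :=
  \int[@lebesgue_measure R]_(t in `]0, l[%classic) f t.

(** The bound is asked on the closed interval, although integration is over the open one:
    compactness then gives integrability. *)
Definition lipschitz_upto l f : Prop := exists k, forall s t,
  0 <= s <= l -> 0 <= t <= l -> `|f s - f t| <= k * `|s - t|.

Lemma lipschitz_upto_cst l (c : R) : lipschitz_upto l (fun=> c).
Proof. by exists 0 => s t _ _; rewrite subrr normr0 mul0r. Qed.

Lemma lipschitz_uptoD l f g : lipschitz_upto l f -> lipschitz_upto l g ->
  lipschitz_upto l (fun t => f t + g t).
Proof.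
move=> [k Hf] [k' Hg]; exists (k + k') => s t hs ht; rewrite mulrDl.
rewrite (_ : _ - _ = (f s - f t) + (g s - g t)); last by ring.
by apply: (le_trans (ler_normD _ _)); rewrite lerD ?Hf ?Hg.
Qed.

Lemma lipschitz_uptoM l (c : R) f : lipschitz_upto l f ->
  lipschitz_upto l (fun t => c * f t).
Proof.
move=> [k Hf]; exists (`|c| * k) => s t hs ht.
by rewrite -mulrBr normrM -mulrA ler_wpM2l ?Hf.
Qed.

Lemma lipschitz_upto_sum l (I : Type) (r : seq I) (P : pred I)
    (F : I -> R -> R) :
  (forall i, P i -> lipschitz_upto l (F i)) ->
  lipschitz_upto l (fun t => \sum_(i <- r | P i) F i t).
Proof.
move=> LF; elim: r => [|i r IHr].
  rewrite [X in lipschitz_upto _ X](_ : _ = fun=> 0); first exact: lipschitz_upto_cst.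
  by apply/funext => t; rewrite big_nil.
rewrite [X in lipschitz_upto _ X](_ : _ = fun t => if P i
    then F i t + \sum_(j <- r | P j) F j t
    else \sum_(j <- r | P j) F j t); last by apply/funext => t; rewrite big_cons.
by case: (boolP (P i)) => // Pi; apply: lipschitz_uptoD => //; exact: LF.
Qed.

Lemma lipschitz_upto_integrable l f : lipschitz_upto l f ->
  (@lebesgue_measure R).-integrable `]0, l[%classic (EFin \o f).
Proof.
move=> [k Hk].
(* The constant [k] may be zero or negative; [|k| + 1] can be divided by. *)
have Hk1 s t : 0 <= s <= l -> 0 <= t <= l ->
    `|f s - f t| <= (`|k| + 1) * `|s - t|.
  move=> hs ht; apply: (le_trans (Hk s t hs ht)).
  by rewrite ler_wpM2r// (le_trans (ler_norm k))// lerDl.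
have k0 : 0 < `|k| + 1 by rewrite ltr_pwDr.
have mI (i : interval R) : measurable [set` i]%classic by exact: measurable_itv.
have sub : (`]0, l[ `<=` `[0, l])%classic by exact: subset_itv_oo_cc.
apply: (@integrableS _ _ _ (@lebesgue_measure R) _ _ _ (mI _) (mI _) sub).
apply: continuous_compact_integrable; first exact: segment_compact.
apply/subspace_continuousP.
move=> x /=; rewrite in_itv/= => hx.
apply/cvgrPdist_lt => e e0; rewrite near_withinE; near=> t.
move=> /=; rewrite in_itv/= => ht.
apply: (le_lt_trans (Hk1 _ _ hx ht)).
rewrite mulrC -ltr_pdivlMr//; near: t.
by apply: cvgr_dist_lt; [exact: cvg_id|exact: divr_gt0].
Unshelve. all: by end_near. Qed.

Lemma eq_interval_integral l f g : (forall t, 0 < t < l -> f t = g t) ->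
  interval_integral l f = interval_integral l g.
Proof.
by move=> fg; apply: eq_Rintegral => t; rewrite inE/= in_itv/=; exact: fg.
Qed.

Lemma Rintegral_cst_itv (a b c : R) : a < b ->
  \int[@lebesgue_measure R]_(t in `]a, b[%classic) c = c * (b - a).
Proof.
move=> ab; rewrite Rintegral_cst; last exact: measurable_itv.
congr (_ * _); transitivity (fine (@lebesgue_measure R `]a, b[%classic)) => //.
by rewrite lebesgue_measure_itv/= lte_fin ab.
Qed.

Lemma interval_integral_cst l (c : R) : 0 < l ->
  interval_integral l (fun=> c) = c * l.
Proof. by move=> l0; rewrite /interval_integral Rintegral_cst_itv// subr0. Qed.

Lemma interval_integralD l f g : lipschitz_upto l f -> lipschitz_upto l g ->
  interval_integral l (fun t => f t + g t) =
  interval_integral l f + interval_integral l g.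
Proof.
move=> Hf Hg; rewrite /interval_integral RintegralD//.
- exact: lipschitz_upto_integrable.
- exact: lipschitz_upto_integrable.
Qed.

Lemma interval_integralM l (c : R) f : lipschitz_upto l f ->
  interval_integral l (fun t => c * f t) = c * interval_integral l f.
Proof.
move=> Hf; rewrite /interval_integral RintegralZl//.
exact: lipschitz_upto_integrable.
Qed.

Lemma le_interval_integral l f g : lipschitz_upto l f -> lipschitz_upto l g ->
  (forall t, 0 < t < l -> f t <= g t) ->
  interval_integral l f <= interval_integral l g.
Proof.
move=> Hf Hg fg; apply: le_Rintegral => //.
exact: lipschitz_upto_integrable.
exact: lipschitz_upto_integrable.
Qed.

(** By the Lipschitz bound, [f] stays above [f t0 / 2] on an interval around [t0]; the rest of the
    domain contributes a nonnegative amount. *)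
Lemma interval_integral_gt0 l f t0 : lipschitz_upto l f ->
  (forall t, 0 < t < l -> 0 <= f t) -> 0 < t0 < l -> 0 < f t0 ->
  0 < interval_integral l f.
Proof.
move=> Lf f0 /andP[t00 t0l] ft0; have [k Hk] := Lf.
pose K := `|k| + 1; have K0 : 0 < K by rewrite ltr_pwDr.
(* The first two bounds keep [J] inside the domain. The third gives [K * d <= f t0 / 2], so [f]
   loses at most half of [f t0] on [J]. *)
pose d := Num.min (Num.min t0 (l - t0)) (f t0 / K / 2).
have d0 : 0 < d by rewrite !lt_min t00 subr_gt0 t0l !divr_gt0.
have [d1 d2 d3] : [/\ d <= t0, d <= l - t0 & d <= f t0 / K / 2].
  by rewrite /d !ge_min !lexx !orbT.
pose J : set R := `]t0 - d, t0 + d[%classic.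
have JI : (J `<=` `]0, l[)%classic.
  by move=> t; rewrite /J/= !in_itv/= => /andP[? ?]; apply/andP; split; lra.
have fJ t : J t -> f t0 / 2 <= f t.
  move=> Jt; have := JI _ Jt; move: Jt; rewrite /J/= !in_itv/= => Jt It.
  have : `|f t0 - f t| <= f t0 / 2.
    apply: (le_trans (Hk _ _ _ _)); [lra|lra|].
    apply: (@le_trans _ _ (K * d)); last first.
      by rewrite mulrC -ler_pdivlMr// mulrAC.
    apply: (@le_trans _ _ (K * `|t0 - t|)).
      by rewrite ler_wpM2r// (le_trans (ler_norm k))// lerDl.
    apply: ler_wpM2l; first exact: ltW.
    by rewrite ler_norml; apply/andP; split; lra.
  by move=> /(le_trans (ler_norm _)); lra.
have mI (i : interval R) : measurable [set` i]%classic by exact: measurable_itv.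
have iJ g : lipschitz_upto l g ->
    (@lebesgue_measure R).-integrable J (EFin \o g).
  move=> /lipschitz_upto_integrable; apply: integrableS => //; exact: mI.
have : f t0 / 2 * (2 * d) <= interval_integral l f.
  apply: (@le_trans _ _ (\int[@lebesgue_measure R]_(t in J) f t)).
    apply: (@le_trans _ _ (\int[@lebesgue_measure R]_(t in J) (f t0 / 2))).
      rewrite Rintegral_cst_itv; last by lra.
      by rewrite (_ : t0 + d - (t0 - d) = 2 * d)//; ring.
    apply: le_Rintegral => //; [exact: mI| |exact: iJ].
    exact/iJ/lipschitz_upto_cst.
  have -> : interval_integral l f = \int[@lebesgue_measure R]_(t in J) f t
      + \int[@lebesgue_measure R]_(t in `]0%R, l[%classic `\` J) f t.
    rewrite /interval_integral -Rintegral_setU.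
    - by rewrite setDUK.
    - exact: mI.
    - by apply: measurableD; exact: mI.
    - by rewrite setDUK//; exact: lipschitz_upto_integrable.
    - by apply/disj_setPS => t [Jt []].
  by rewrite lerDl; apply: Rintegral_ge0 => t [It _]; exact: f0.
by apply: lt_le_trans; rewrite !mulr_gt0// divr_gt0.
Qed.
End LipschitzIntegrals.

(** * Single and double integrals over sets of edges *)

Section EdgeIntegrals.
Variables (R : realType) (E : finType) (l : E -> R).
Implicit Types (Q : pred E) (g a : E -> R -> R) (d : E -> R -> E -> R -> R).

Definition edge_integral Q g : R := \sum_(e | Q e) interval_integral (l e) (g e).

Definition double_edge_integral Q Q' d : R :=
  edge_integral Q (fun e s => edge_integral Q' (d e s)).

Definition edges_length Q : R := \sum_(e | Q e) l e.

(** This is the regularity shared by all distance kernels; it makes the integrands of both the inner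
    and the outer integral Lipschitz. *)
Definition nonexpansive_kernel d : Prop :=
  (forall e f s s' t, 0 <= s <= l e -> 0 <= s' <= l e -> 0 <= t <= l f ->
    `|d e s f t - d e s' f t| <= `|s - s'|) /\
  (forall e f s t t', 0 <= s <= l e -> 0 <= t <= l f -> 0 <= t' <= l f ->
    `|d e s f t - d e s f t'| <= `|t - t'|).

Hypothesis l_gt0 : forall e, 0 < l e.

Lemma eq_edge_integral Q g g' :
  (forall e t, Q e -> 0 < t < l e -> g e t = g' e t) ->
  edge_integral Q g = edge_integral Q g'.
Proof.
move=> gg'; apply: eq_bigr => e Qe; apply: eq_interval_integral => t.
exact: gg'.
Qed.

Lemma edge_integral_cst Q (c : R) :
  edge_integral Q (fun _ _ => c) = c * edges_length Q.
Proof.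
by rewrite mulr_sumr; apply: eq_bigr => e _; rewrite interval_integral_cst.
Qed.

Lemma edge_integralD Q g g' :
  (forall e, Q e -> lipschitz_upto (l e) (g e)) ->
  (forall e, Q e -> lipschitz_upto (l e) (g' e)) ->
  edge_integral Q (fun e t => g e t + g' e t) =
  edge_integral Q g + edge_integral Q g'.
Proof.
move=> Lg Lg'; rewrite -big_split; apply: eq_bigr => e Qe.
by rewrite interval_integralD; [|exact: Lg|exact: Lg'].
Qed.

Lemma edge_integralM Q (c : R) g :
  (forall e, Q e -> lipschitz_upto (l e) (g e)) ->
  edge_integral Q (fun e t => c * g e t) = c * edge_integral Q g.
Proof.
move=> Lg; rewrite mulr_sumr; apply: eq_bigr => e Qe.
by rewrite interval_integralM//; exact: Lg.
Qed.

Lemma le_edge_integral Q g g' :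
  (forall e, Q e -> lipschitz_upto (l e) (g e)) ->
  (forall e, Q e -> lipschitz_upto (l e) (g' e)) ->
  (forall e t, Q e -> 0 < t < l e -> g e t <= g' e t) ->
  edge_integral Q g <= edge_integral Q g'.
Proof.
move=> Lg Lg' gg'; apply: ler_sum => e Qe; apply: le_interval_integral.
- exact: Lg.
- exact: Lg'.
- by move=> t; exact: gg'.
Qed.

(** The difference [g' - g] is Lipschitz, nonnegative, and positive at one point of [e0], so its
    integral over [e0] is positive. *)
Lemma lt_edge_integral Q g g' e0 t0 :
  (forall e, Q e -> lipschitz_upto (l e) (g e)) ->
  (forall e, Q e -> lipschitz_upto (l e) (g' e)) ->
  (forall e t, Q e -> 0 < t < l e -> g e t <= g' e t) ->
  Q e0 -> 0 < t0 < l e0 -> g e0 t0 < g' e0 t0 ->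
  edge_integral Q g < edge_integral Q g'.
Proof.
move=> Lg Lg' gg' Q0 t0l gg0.
have LN e : Q e -> lipschitz_upto (l e) (fun t => -1 * g e t).
  by move=> Qe; exact/lipschitz_uptoM/Lg.
have LB e : Q e -> lipschitz_upto (l e) (fun t => g' e t + -1 * g e t).
  by move=> Qe; apply: lipschitz_uptoD; [exact: Lg'|exact: LN].
have ge0 e t : Q e -> 0 < t < l e -> 0 <= g' e t + -1 * g e t.
  by move=> Qe tl; rewrite mulN1r subr_ge0 gg'.
rewrite -subr_gt0 -mulN1r -edge_integralM// -edge_integralD//.
rewrite /edge_integral (bigD1 e0)//= ltr_pwDl//.
  apply: (@interval_integral_gt0 _ _ _ t0) => //; first exact: LB.
    by move=> t; exact: ge0.
  by rewrite mulN1r subr_gt0.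
apply: sumr_ge0 => e /andP[Qe _].
by apply: Rintegral_ge0 => t tl; exact: ge0.
Qed.

(** Moving [s] to [s'] changes the integrand by at most [|s - s'|] throughout an interval of length
    [l2], hence the constant [l2]. *)
Lemma lipschitz_upto_interval_integral (l1 l2 : R) (h : R -> R -> R) :
  0 < l2 ->
  (forall s s' t, 0 <= s <= l1 -> 0 <= s' <= l1 -> 0 <= t <= l2 ->
    `|h s t - h s' t| <= `|s - s'|) ->
  (forall s, 0 <= s <= l1 -> lipschitz_upto l2 (h s)) ->
  lipschitz_upto l1 (fun s => interval_integral l2 (h s)).
Proof.
move=> l20 h1 Lh; exists l2.
have H s s' : 0 <= s <= l1 -> 0 <= s' <= l1 ->
    interval_integral l2 (h s) <= interval_integral l2 (h s') + l2 * `|s - s'|.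
  move=> hs hs'; rewrite mulrC -interval_integral_cst// -interval_integralD.
  - apply: le_interval_integral; first exact: Lh.
      by apply: lipschitz_uptoD; [exact: Lh|exact: lipschitz_upto_cst].
    move=> t /andP[t0 tl]; rewrite -lerBlDl; apply: (le_trans (ler_norm _)).
    by apply: h1; rewrite // !ltW.
  - exact: Lh.
  - exact: lipschitz_upto_cst.
move=> s t hs ht; rewrite ler_norml lerBlDl H// andbT.
by rewrite lerBrDr -lerBrDl opprK distrC H.
Qed.

Section Kernel.
Variable d : E -> R -> E -> R -> R.
Hypothesis d_nonexp : nonexpansive_kernel d.

Lemma kernel_lipschitz e s f : 0 <= s <= l e -> lipschitz_upto (l f) (d e s f).
Proof.
by move=> hs; exists 1 => t t' ht ht'; rewrite mul1r; apply: d_nonexp.2.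
Qed.

Lemma kernel_lipschitz_integral Q e :
  lipschitz_upto (l e) (fun s => edge_integral Q (d e s)).
Proof.
apply: lipschitz_upto_sum => f _; apply: lipschitz_upto_interval_integral => //.
- by move=> s s' t *; apply: d_nonexp.1.
- by move=> s; exact: kernel_lipschitz.
Qed.

Lemma double_edge_integral_split Q :
  double_edge_integral predT predT d =
  double_edge_integral Q Q d + double_edge_integral (predC Q) (predC Q) d +
  (double_edge_integral Q (predC Q) d + double_edge_integral (predC Q) Q d).
Proof.
have inner P : double_edge_integral P predT d =
    double_edge_integral P Q d + double_edge_integral P (predC Q) d.
  rewrite /double_edge_integral -edge_integralD.
  - by apply: eq_edge_integral => e t _ _; rewrite /edge_integral (bigID Q).
  - by move=> e _; exact: kernel_lipschitz_integral.
  - by move=> e _; exact: kernel_lipschitz_integral.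
rewrite {1}/double_edge_integral {1}/edge_integral (bigID Q)/=.
rewrite -!/(edge_integral _ _) -!/(double_edge_integral _ _ _) !inner.
by ring.
Qed.

(** Each summand depends on one variable only, so integrating over the other one gives a length as a
    factor. In the application [a] is the distance to a cut vertex. *)
Lemma double_edge_integral_cross Q Q' a :
  (forall e, lipschitz_upto (l e) (a e)) ->
  (forall e s f t, Q e -> Q' f -> 0 < s < l e -> 0 < t < l f ->
    d e s f t = a e s + a f t) ->
  double_edge_integral Q Q' d =
  edges_length Q' * edge_integral Q a + edges_length Q * edge_integral Q' a.
Proof.
move=> La da; rewrite -edge_integralM// [X in _ + X]mulrC -edge_integral_cst.
rewrite -edge_integralD; last first.
- by move=> e _; exact: lipschitz_upto_cst.
- by move=> e _; exact: lipschitz_uptoM.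
apply: eq_edge_integral => e s Qe hs.
rewrite mulrC -edge_integral_cst -edge_integralD//; last first.
  by move=> f _; exact: lipschitz_upto_cst.
by apply: eq_edge_integral => f t Qf ht; exact: da.
Qed.

End Kernel.

(** Strictness at one pair of points passes to the inner integral at [(e, s)], and from there to the
    outer one. *)
Lemma lt_double_edge_integral d d' e s f t :
  nonexpansive_kernel d -> nonexpansive_kernel d' ->
  (forall e s f t, 0 < s < l e -> 0 < t < l f -> d e s f t <= d' e s f t) ->
  0 < s < l e -> 0 < t < l f -> d e s f t < d' e s f t ->
  double_edge_integral predT predT d < double_edge_integral predT predT d'.
Proof.
move=> nd nd' dd' hs ht dlt.
have hsw e' (s' : R) : 0 < s' < l e' -> 0 <= s' <= l e'.
  by move=> /andP[/ltW-> /ltW->].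
apply: (@lt_edge_integral _ _ _ e s) => //.
- by move=> *; exact: kernel_lipschitz_integral.
- by move=> *; exact: kernel_lipschitz_integral.
- move=> e' s' _ hs'; apply: le_edge_integral => //.
  + by move=> *; apply: kernel_lipschitz => //; exact: hsw.
  + by move=> *; apply: kernel_lipschitz => //; exact: hsw.
  + by move=> f' t' _ ht'; exact: dd'.
apply: (@lt_edge_integral _ _ _ f t) => //.
- by move=> *; apply: kernel_lipschitz => //; exact: hsw.
- by move=> *; apply: kernel_lipschitz => //; exact: hsw.
- by move=> f' t' _ ht'; exact: dd'.
Qed.

End EdgeIntegrals.

(** * Transport of edge integrals along an injection of edges *)

Section Reindexing.
Variables (R : realType) (E E' : finType) (l : E -> R) (l' : E' -> R).
Variables (phi : E' -> E) (Q : pred E).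
Hypotheses (phi_inj : injective phi) (Qphi : forall e, Q e = (e \in codom phi)).
Hypothesis l_phi : forall e, l' e = l (phi e).

Lemma sum_codom (F : E -> R) : \sum_(e | Q e) F e = \sum_e F (phi e).
Proof.
rewrite (eq_bigl (mem (phi @: E')%SET)); last first.
  move=> e; rewrite Qphi/=; apply/codomP/imsetP => [[x ->]|[x _ ->]];
  by exists x.
by rewrite big_imset//= => x y _ _; exact: phi_inj.
Qed.

Lemma edges_length_reindex : edges_length l Q = edges_length l' predT.
Proof. by rewrite /edges_length sum_codom; apply: eq_bigr => e _. Qed.

Lemma edge_integral_reindex g g' :
  (forall e t, 0 < t < l' e -> g (phi e) t = g' e t) ->
  edge_integral l Q g = edge_integral l' predT g'.
Proof.
move=> gg'; rewrite /edge_integral sum_codom; apply: eq_bigr => e _.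
by rewrite -l_phi; apply: eq_interval_integral => t; exact: gg'.
Qed.

Lemma double_edge_integral_reindex d d' :
  (forall e s f t, 0 < s < l' e -> 0 < t < l' f ->
    d (phi e) s (phi f) t = d' e s f t) ->
  double_edge_integral l Q Q d = double_edge_integral l' predT predT d'.
Proof.
move=> dd'; apply: edge_integral_reindex => e s hs.
by apply: edge_integral_reindex => f t ht; exact: dd'.
Qed.

End Reindexing.

(** * Paths, the distance, and nonexpansive functions *)

Section Paths.
Variables (R : realType) (G : metric_graph R).
Implicit Types (x y z : graph_point G) (e : edge G) (s t L : R).

Lemma edge_point_start e : edge_point e 0 = inl (inc G (e, false)).
Proof. by rewrite /edge_point insubF//= ltxx. Qed.

Lemma edge_point_end e : edge_point e (len G e) = inl (inc G (e, true)).
Proof. by rewrite /edge_point insubF/= ?ltxx ?andbF// len_gt0. Qed.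

Lemma edge_point_inr (p : {p : edge G * R | 0 < p.2 < len G p.1}) :
  edge_point (val p).1 (val p).2 = inr p.
Proof. by rewrite /edge_point -surjective_pairing valK. Qed.

Lemma edge_point_interior e t : 0 < t < len G e ->
  exists2 p : {p : edge G * R | 0 < p.2 < len G p.1},
    val p = (e, t) & edge_point e t = inr p.
Proof.
move=> tl; exists (Sub (e, t) tl : {p : edge G * R | 0 < p.2 < len G p.1}) => //.
by rewrite -edge_point_inr.
Qed.

Lemma closed_edgeP e t : 0 <= t <= len G e ->
  [\/ t = 0, t = len G e | 0 < t < len G e].
Proof.
move=> /andP[]; rewrite !le_eqVlt => /predU1P[<-|t0]; first by constructor 1.
by move=> /predU1P[->|->]; [constructor 2|constructor 3; rewrite t0].
Qed.

Lemma graph_pointP (P : graph_point G -> Prop) :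
  (forall u, P (inl u)) -> (forall e t, 0 < t < len G e -> P (edge_point e t)) ->
  forall x, P x.
Proof.
by move=> Pv Pe [u//|p]; rewrite -edge_point_inr; exact: Pe (valP p).
Qed.

Lemma path_length_ge0 x y L : path_length x y L -> 0 <= L.
Proof. by elim=> // *; rewrite addr_ge0. Qed.

Lemma path_length_trans x y z L L' :
  path_length x y L -> path_length y z L' -> path_length x z (L + L').
Proof.
elim=> [|e s t {}y {}L hs ht _ IH] p; first by rewrite add0r.
by rewrite -addrA; apply: path_cons => //; exact: IH.
Qed.

Lemma path_length_edge e s t : 0 <= s <= len G e -> 0 <= t <= len G e ->
  path_length (edge_point e s) (edge_point e t) `|s - t|.
Proof.
by move=> hs ht; have := path_cons hs ht (path_nil _); rewrite addr0.
Qed.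

Lemma path_length_sym x y L : path_length x y L -> path_length y x L.
Proof.
elim=> [z|e s t {}y {}L hs ht _ IH]; first exact: path_nil.
rewrite addrC distrC; apply: path_length_trans IH _.
exact: path_length_edge.
Qed.

(** The infimum of the empty set is [0] by convention, so nontrivial lower bounds on [dist] require
    a path between the points. *)
Definition path_connected : Prop := forall x y, exists L, path_length x y L.

(** A walk along adjacent vertices becomes a path edge by edge, and an interior point is joined to
    the start of its edge. *)
Lemma connected_graph_path : connected_graph G -> path_connected.
Proof.
move=> /andP[_ /forallP conn].
have vv u w : exists L, path_length (inl u : graph_point G) (inl w) L.
  have /connectP[p up ->] := forallP (conn u) w.
  elim: p u up => [|a p IHp] u /=; first by exists 0; exact: path_nil.
  move=> /andP[/existsP[e /existsP[b /andP[/eqP <- /eqP ea]]] /IHp[L pL]].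
  have [L1 pL1] : exists L, path_length (inl (inc G (e, b)) : graph_point G)
      (inl (inc G (e, ~~ b))) L.
    have l0 := ltW (len_gt0 e).
    have p01 : path_length (inl (inc G (e, false)) : graph_point G)
        (inl (inc G (e, true))) `|0 - len G e|.
      rewrite -edge_point_start -edge_point_end.
      by apply: path_length_edge; rewrite lexx l0.
    by exists `|0 - len G e|; case: b {ea} => //=; exact: path_length_sym.
  by exists (L1 + L); apply: path_length_trans pL1 _; rewrite ea.
have vx x : exists u L, path_length x (inl u) L.
  elim/graph_pointP: x => [u|e t /andP[t0 tl]].
    by exists u, 0; exact: path_nil.
  exists (inc G (e, false)), `|t - 0|; rewrite -edge_point_start.
  by apply: path_length_edge; rewrite ?lexx (ltW t0, ltW (len_gt0 e)) // ltW.
move=> x y; have [u [L xu]] := vx x; have [w [L' yw]] := vx y.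
have [L'' uw] := vv u w; exists (L + (L'' + L')).
apply: path_length_trans xu _; apply: path_length_trans uw _.
exact: path_length_sym.
Qed.

(** These are the test functions whose differences bound [dist] from below. *)
Definition nonexpansive (F : graph_point G -> R) : Prop := forall e s t,
  0 <= s <= len G e -> 0 <= t <= len G e ->
  `|F (edge_point e s) - F (edge_point e t)| <= `|s - t|.

Lemma nonexpansive_path F x y L : nonexpansive F ->
  path_length x y L -> `|F x - F y| <= L.
Proof.
move=> Fe; elim=> [z|e s t {}y {}L hs ht _ IH]; first by rewrite subrr normr0.
by apply: (le_trans (ler_distD (F (edge_point e t)) _ _)); rewrite lerD ?Fe.
Qed.

Lemma dist_le_path x y L : path_length x y L -> dist x y <= L.
Proof.
by move=> p; apply: ge_inf => //; exists 0 => L' /=; exact: path_length_ge0.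
Qed.

Lemma dist_ge0 x y : 0 <= dist x y.
Proof.
have [[L pL]|nP] := pselect (exists L, path_length x y L).
  by apply: lb_le_inf; [exists L|move=> L' /=; exact: path_length_ge0].
rewrite /dist (_ : mkset _ = set0) ?inf0//.
by apply/seteqP; split => // L pL; case: nP; exists L.
Qed.

Lemma dist_sym x y : dist x y = dist y x.
Proof.
by congr inf; apply/seteqP; split => L; exact: path_length_sym.
Qed.

Lemma dist_edge e s t : 0 <= s <= len G e -> 0 <= t <= len G e ->
  dist (edge_point e s) (edge_point e t) <= `|s - t|.
Proof. by move=> hs ht; apply/dist_le_path/path_length_edge. Qed.

Lemma distxx x : dist x x = 0.
Proof.
by apply/eqP; rewrite eq_le dist_ge0 andbT; apply/dist_le_path/path_nil.
Qed.

Hypothesis conn : path_connected.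

Lemma le_dist (c : R) x y :
  (forall L, path_length x y L -> c <= L) -> c <= dist x y.
Proof. by move=> H; apply: lb_le_inf; [exact: conn|move=> L /=; exact: H]. Qed.

Lemma dist_triangle y x z : dist x z <= dist x y + dist y z.
Proof.
rewrite -lerBlDr; apply: le_dist => L xy; rewrite lerBlDr -lerBlDl.
by apply: le_dist => L' yz; rewrite lerBlDl; apply/dist_le_path/path_length_trans/yz.
Qed.

Lemma nonexpansive_dist F x y : nonexpansive F -> `|F x - F y| <= dist x y.
Proof. by move=> Fe; apply: le_dist => L; exact: nonexpansive_path. Qed.

Lemma dist_nonexpansive x : nonexpansive (dist x).
Proof.
move=> e s t hs ht; have := dist_edge hs ht.
have := dist_triangle (edge_point e s) x (edge_point e t).
have := dist_triangle (edge_point e t) x (edge_point e s).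
rewrite (dist_sym (edge_point e t) (edge_point e s)) => h1 h2 h3.
by rewrite ler_norml; apply/andP; split; lra.
Qed.

Lemma dist_kernel_nonexpansive : nonexpansive_kernel (len G)
  (fun e s f t => dist (edge_point e s) (edge_point f t)).
Proof.
split=> [e f s s' t hs hs' ht|e f s t t' hs ht ht']; last exact: dist_nonexpansive.
by rewrite !(dist_sym _ (edge_point f t)); exact: dist_nonexpansive.
Qed.

End Paths.

(** * Maps of graphs that keep or contract each edge *)

Section CollapsingMaps.
Variables (R : realType) (G G' : metric_graph R).
Variables (fv : vertex G -> vertex G') (fe : edge G -> option (edge G')).

(* Edges with image [None] are contracted to the image of their ends. *)
Definition is_collapse : Prop := forall e,
  if fe e is Some e' then len G' e' = len G e /\
    forall b, inc G' (e', b) = fv (inc G (e, b))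
  else fv (inc G (e, false)) = fv (inc G (e, true)).

Definition collapse (x : graph_point G) : graph_point G' :=
  match x with
  | inl u => inl (fv u)
  | inr p => if fe (val p).1 is Some e' then edge_point e' (val p).2
             else inl (fv (inc G ((val p).1, false)))
  end.

Hypothesis fP : is_collapse.

Lemma collapse_edge e e' t : fe e = Some e' -> 0 <= t <= len G e ->
  collapse (edge_point e t) = edge_point e' t.
Proof.
move=> fee tl; have := fP e; rewrite fee => -[le incE].
case: (closed_edgeP tl) => [->|->|{}tl].
- by rewrite !edge_point_start incE.
- by rewrite -[in RHS]le !edge_point_end incE.
- by have [p pE ->] := edge_point_interior tl; rewrite /= pE /= fee.
Qed.

Lemma collapse_contracted e t : fe e = None -> 0 <= t <= len G e ->
  collapse (edge_point e t) = inl (fv (inc G (e, false))).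
Proof.
move=> fee tl; have := fP e; rewrite fee => incE.
case: (closed_edgeP tl) => [->|->|{}tl].
- by rewrite !edge_point_start.
- by rewrite !edge_point_end/= incE.
- by have [p pE ->] := edge_point_interior tl; rewrite /= pE /= fee.
Qed.

(** Segments on kept edges keep their length and segments on contracted edges are dropped, so the
    image path is no longer than the original. *)
Lemma path_length_collapse x y L : path_length x y L ->
  exists2 L', L' <= L & path_length (collapse x) (collapse y) L'.
Proof.
elim=> [z|e s t {}y {}L hs ht _ [L' L'L IH]].
  by exists 0 => //; exact: path_nil.
case fee : (fe e) => [e'|]; last first.
  exists L'; first by rewrite (le_trans L'L)// lerDr.
  by rewrite (collapse_contracted fee hs) -(collapse_contracted fee ht).
exists (`|s - t| + L'); first by rewrite lerD2l.
have := fP e; rewrite fee => -[le _].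
rewrite (collapse_edge fee hs); apply: path_cons; rewrite ?le//.
by rewrite -(collapse_edge fee ht).
Qed.

Lemma dist_collapse x y : path_connected G ->
  dist (collapse x) (collapse y) <= dist x y.
Proof.
move=> conn; apply: le_dist => // L /path_length_collapse[L' L'L p].
by rewrite (le_trans _ L'L)//; exact: dist_le_path.
Qed.

End CollapsingMaps.

(** * Distances through a cut vertex *)

Section CutPoint.
Variables (R : realType) (G : metric_graph R) (c : vertex G) (Q : pred (edge G)).
Hypothesis conn : path_connected G.
Hypothesis separates : forall x y : edge G * bool,
  Q x.1 -> ~~ Q y.1 -> inc G x = inc G y -> inc G x = c.

(* The distance to [c], signed by the side of [c], is nonexpansive: it shows that
   a path from one side to the other is no shorter than a path through [c]. *)
Lemma dist_through_cut_point e s f t : Q e -> ~~ Q f ->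
  0 <= s <= len G e -> 0 <= t <= len G f ->
  dist (edge_point e s) (edge_point f t) =
  dist (inl c) (edge_point e s) + dist (inl c) (edge_point f t).
Proof.
move=> Qe Qf hs ht; apply/eqP; rewrite eq_le; apply/andP; split.
  by rewrite (dist_sym (inl c) (edge_point e s)); exact: dist_triangle.
(* A vertex touched by an edge of [Q] counts as lying on the side of [Q]. By [separates], an edge
   outside [Q] can end at such a vertex only if it is [c], where the distance is [0] and its sign
   does not matter. *)
pose side (x : graph_point G) := match x with
  | inl u => [exists z, Q z.1 && (inc G z == u)] | inr p => Q (val p).1 end.
pose F x := if side x then - dist (inl c) x else dist (inl c) x.
have FE e' r : 0 <= r <= len G e' -> F (edge_point e' r) =
    if Q e' then - dist (inl c) (edge_point e' r)
    else dist (inl c) (edge_point e' r).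
  move=> hr; have vertexE b : F (inl (inc G (e', b))) = if Q e'
      then - dist (inl c) (inl (inc G (e', b)))
      else dist (inl c) (inl (inc G (e', b))).
    rewrite /F/=; case: ifPn => [/existsP[z /andP[Qz /eqP zE]]|].
      case: ifPn => // Q'; rewrite -zE (@separates z (e', b) Qz Q' zE) ?distxx ?oppr0//.
    by case: ifPn => // Q' /existsP[]; exists (e', b); rewrite Q' /=.
  case: (closed_edgeP hr) => [->|->|{}hr].
  - by rewrite edge_point_start.
  - by rewrite edge_point_end.
  - by rewrite /F; have [p pE ->] := edge_point_interior hr; rewrite /= pE.
have Fne : nonexpansive F.
  move=> e' r r' hr hr'; rewrite !FE//; case: ifPn => _.
    by rewrite -opprD normrN; exact: dist_nonexpansive.
  exact: dist_nonexpansive.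
(* The signs differ on the two sides, so the difference of the values of [F] is, up to sign, the sum
   of the two distances to [c]. *)
have := nonexpansive_dist conn (edge_point e s) (edge_point f t) Fne.
by rewrite !FE// Qe (negbTE Qf) -opprD normrN; exact/le_trans/ler_norm.
Qed.

End CutPoint.

Lemma norm_minB_le (R : realDomainType) (a b a' b' r : R) :
  `|a - a'| <= r -> `|b - b'| <= r -> `|Num.min a b - Num.min a' b'| <= r.
Proof.
rewrite !ler_norml => /andP[? ?] /andP[? ?].
by case: (leP a b) => ?; case: (leP a' b') => ?; apply/andP; split; lra.
Qed.

(** * Mean distances as double integrals, and local distance bounds *)

Section MeanDistance.
Variables (R : realType) (G : metric_graph R).

Definition dist_kernel (e : edge G) (s : R) (f : edge G) (t : R) : R :=
  dist (edge_point e s) (edge_point f t).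

Lemma total_length_ge0 : 0 <= total_length G.
Proof. by apply: sumr_ge0 => e _; exact/ltW/len_gt0. Qed.

Lemma total_length_gt0 (e : edge G) : 0 < total_length G.
Proof.
rewrite /total_length (bigD1 e)//= ltr_pwDl ?len_gt0//.
by apply: sumr_ge0 => e' _; exact/ltW/len_gt0.
Qed.

Lemma mean_distance_funE (x : graph_point G) : mean_distance_fun x =
  (total_length G)^-1 *
  edge_integral (len G) predT (fun e t => dist x (edge_point e t)).
Proof. by []. Qed.

(** Connectedness makes the inner integral Lipschitz in the outer variable, which allows the inner
    normalizing factor to be taken out. *)
Lemma mean_distanceE : path_connected G -> mean_distance G =
  (total_length G)^-1 ^+ 2 *
  double_edge_integral (len G) predT predT dist_kernel.
Proof.
move=> conn; rewrite expr2 -mulrA -edge_integralM => [//|e _].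
exact: (kernel_lipschitz_integral (@len_gt0 R G)
  (dist_kernel_nonexpansive conn)).
Qed.

Lemma edge_point_near_end e b (r : R) : 0 <= r <= len G e ->
  dist (inl (inc G (e, b))) (edge_point e (if b then len G e - r else r)) <= r.
Proof.
move=> /andP[r0 rl]; have l0 := ltW (len_gt0 e).
have -> : inl (inc G (e, b)) = edge_point e (if b then len G e else 0).
  by case: b; rewrite ?edge_point_end ?edge_point_start.
apply: le_trans (dist_edge _ _) _; case: b; rewrite ?lexx ?l0 ?r0//.
- by apply/andP; split; lra.
- by rewrite opprB addrC subrK ger0_norm.
- by rewrite sub0r normrN ger0_norm.
Qed.

Lemma min_edge_length : exists2 m : R, 0 < m & forall e, m <= len G e.
Proof.
(* The minimum starts from [1], so it is positive even without edges. *)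
exists (\big[Num.min/1]_(e : edge G) len G e).
  by elim/big_ind: _ => [//|x y x0 y0|e _]; rewrite ?lt_min ?x0 ?len_gt0.
by move=> e; exact: bigmin_le_cond.
Qed.

(** The test function is [0] at [w], grows with slope 1 away from [w], and is capped at [m], its
    value at every other vertex. *)
Lemma dist_vertices_ge (m : R) (w w' : vertex G) : path_connected G ->
  0 < m -> (forall e, m <= len G e) -> w' != w -> m <= dist (inl w') (inl w).
Proof.
move=> conn m0 ml ww'.
(* An end of [e] at [w] contributes the distance along [e] to that end, any other end the cap [m]; a
   loop at [w] uses both branches. As [m <= len G e], the values at the ends agree with those at the
   vertices. *)
pose tent e (t : R) := Num.min m
  (Num.min (if inc G (e, false) == w then t else m)
           (if inc G (e, true) == w then len G e - t else m)).
pose F (x : graph_point G) := match x with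
  | inl u => if u == w then 0 else m | inr p => tent (val p).1 (val p).2 end.
have FE e t : 0 <= t <= len G e -> F (edge_point e t) = tent e t.
  move=> ht; have l0 := ml e.
  case: (closed_edgeP ht) => [->|->|{}ht].
  - rewrite edge_point_start /F /tent subr0.
    case: (inc G (e, false) == w).
      by rewrite [Num.min 0 _]min_l ?min_r//; do ?[case: ifP => _]; lra.
    by rewrite [Num.min m (if _ then _ else _)]min_l ?minxx//; do ?[case: ifP => _]; lra.
  - rewrite edge_point_end /F /tent subrr.
    case: (inc G (e, true) == w).
      by rewrite [Num.min _ 0]min_r ?min_r//; do ?[case: ifP => _]; lra.
    by rewrite [Num.min _ m]min_r ?minxx//; do ?[case: ifP => _]; lra.
  - by have [p pE ->] := edge_point_interior ht; rewrite /= pE.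
have Fne : nonexpansive F.
  move=> e s t hs ht; rewrite !FE// /tent.
  apply: norm_minB_le; first by rewrite subrr normr0.
  apply: norm_minB_le; case: ifP => _; rewrite ?subrr ?normr0//.
  by rewrite distrC (_ : _ - _ = s - t)//; ring.
have := nonexpansive_dist conn (inl w') (inl w) Fne.
rewrite /F eqxx (negbTE ww') subr0; exact/le_trans/ler_norm.
Qed.

End MeanDistance.

(** * Cutting through a vertex *)

Section CuttingVertex.
Variables (R : realType) (G : metric_graph R) (v : vertex G).
Variables (P : {set {set edge G * bool}}).
Hypothesis partP : finset.partition P (ends_at v).
Let Gc := cut_graph partP.

Definition uncut_vertex (z : vertex Gc) : vertex G :=
  if val z is inl u then u else v.

Lemma uncut_collapse : is_collapse uncut_vertex (fun e : edge Gc => Some e).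
Proof.
move=> e; split=> // b.
by rewrite /uncut_vertex /= /cut_end; case: eqP.
Qed.

(** Gluing the classes back is a collapse that contracts no edge and keeps the parameters along the
    edges. *)
Lemma le_dist_cut e s f t : path_connected Gc ->
  0 <= s <= len G e -> 0 <= t <= len G f ->
  dist_kernel (G := G) e s f t <= dist_kernel (G := Gc) e s f t.
Proof.
move=> conn hs ht; have := dist_collapse uncut_collapse
  (@edge_point _ Gc e s) (@edge_point _ Gc f t) conn.
by rewrite !(collapse_edge uncut_collapse erefl).
Qed.

(** If all ends at [v] lay in one class, this class would be all of [ends_at v] and the partition
    would be trivial. *)
Lemma separated_ends : connected_graph G -> connected_graph Gc ->
  P <> [set ends_at v]%SET ->
  exists z1 z2, [/\ inc G z1 = v, inc G z2 = v & inc Gc z1 != inc Gc z2].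
Proof.
move=> /andP[_ /forallP connG] /andP[Gc0 _] Pv.
(* With no end at [v], connectedness leaves [v] as the only vertex of [G], and [P] is empty; the cut
   graph would then have no vertex. *)
have [[z zv]|noend] := pselect (exists z, inc G z = v); last first.
  have ends0 : ends_at v = finset.set0.
    by apply/setP => z; rewrite !inE; apply/eqP => zv; apply: noend; exists z.
  have [[[u|B] /= zP]] := card_gt0P Gc0.
    move: (zP) => /negP[]; have /forallP/(_ u)/connectP[[|a p]/=] := connG v.
      by move=> _ ->.
    move=> /andP[/existsP[e /existsP[b /andP[/eqP ev _]]] _] _.
    by case: noend; exists (e, b).
  move=> _; have B0 : finset.set0 = B; last first.
    by move: zP; rewrite -B0 (partition0 partP).
  apply/esym/eqP; rewrite -finset.subset0 -ends0 -(cover_partition partP).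
  exact: finset.bigcup_sup.
have ends_in B : B \in P -> B \subset ends_at v.
  by move=> BP; rewrite -(cover_partition partP); exact: finset.bigcup_sup.
have zends : z \in ends_at v by rewrite inE zv.
have zP : finset.pblock P z \in P by rewrite pblock_mem// (cover_partition partP).
have [//|same] := pselect (exists z1 z2,
  [/\ inc G z1 = v, inc G z2 = v & inc Gc z1 != inc Gc z2]).
have block z1 z2 : inc G z1 = v -> inc G z2 = v ->
    finset.pblock P z1 = finset.pblock P z2.
  move=> z1v z2v; have [/(congr1 val)/=|neq] := eqVneq (inc Gc z1) (inc Gc z2).
    by rewrite /cut_end z1v z2v eqxx => -[].
  by case: same; exists z1, z2.
case: Pv; apply/setP => B; rewrite inE.
have full C : C \in P -> C = ends_at v.
  move=> CP; apply/eqP; rewrite finset.eqEsubset ends_in//=; apply/fintype.subsetP => y.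
  rewrite inE => /eqP yv; have /set0Pn[x xC] : C != finset.set0.
    by apply: contraTneq CP => ->; rewrite (partition0 partP).
  have /fintype.subsetP/(_ _ xC) := ends_in _ CP; rewrite inE => /eqP xv.
  rewrite -(def_pblock (partition_trivIset partP) CP xC) (block _ _ xv yv).
  by rewrite mem_pblock (cover_partition partP) inE yv.
by apply/idP/eqP => [/full//|->]; rewrite -(full _ zP).
Qed.

Lemma mean_distance_cut : connected_graph G -> connected_graph Gc ->
  P <> [set ends_at v]%SET -> mean_distance G < mean_distance Gc.
Proof.
move=> Gconn Gcconn Pv.
have [[e1 b1] [[e2 b2] [z1v z2v z12]]] := separated_ends Gconn Gcconn Pv.
have pG := connected_graph_path Gconn; have pGc := connected_graph_path Gcconn.
have [m m0 ml] := min_edge_length G.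
rewrite !mean_distanceE// ltr_pM2l; last first.
  by rewrite exprn_gt0// invr_gt0 (@total_length_gt0 _ G e1).
(* The witnesses lie [m / 5] away from two ends that the cut separates. In [G] their distance is at
   most [2 * m / 5], through [v]; in the cut graph the new vertices are at least [m] apart, which
   leaves at least [3 * m / 5]. *)
pose param e (b : bool) := if b then len G e - m / 5 else m / 5.
have hparam e b : 0 < param e b < len G e.
  by have := ml e; rewrite /param; case: b => ?; apply/andP; split; lra.
have m5 e : 0 <= m / 5 <= len G e.
  by have := ml e => ?; apply/andP; split; lra.
apply: (@lt_double_edge_integral _ _ _ (@len_gt0 R G) _ _
  e1 (param e1 b1) e2 (param e2 b2)) => //.
- exact: dist_kernel_nonexpansive.
- exact: (@dist_kernel_nonexpansive _ Gc).
- move=> e s f t /andP[s0 sl] /andP[t0 tl].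
  by apply: le_dist_cut => //; rewrite !ltW.
rewrite /dist_kernel.
have h5 := dist_vertices_ge pGc m0 ml z12.
have := @edge_point_near_end _ Gc e1 b1 _ (m5 e1).
have := @edge_point_near_end _ Gc e2 b2 _ (m5 e2).
have := @edge_point_near_end _ G e1 b1 _ (m5 e1).
have := @edge_point_near_end _ G e2 b2 _ (m5 e2).
rewrite -!/(param _ _) z1v z2v.
move: (edge_point e1 _) (edge_point e2 _) => x1 x2.
move: (inl (inc Gc (e1, b1))) (inl (inc Gc (e2, b2))) (@edge_point _ Gc e1 _)
  (@edge_point _ Gc e2 _) h5
  => w1 w2 y1 y2 h5 h2 h1 h4 h3.
have := dist_triangle pG (inl v) x1 x2.
have := dist_triangle pGc y1 w1 w2.
have := dist_triangle pGc y2 y1 w2.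
rewrite (dist_sym y2 w2) (dist_sym x1 (inl v)).
lra.
Qed.

End CuttingVertex.

(** * The double integral over a graph with a cut vertex *)

Section PendantDecomposition.
Variables (R : realType) (G : metric_graph R).

(** Clearing the denominator is legitimate even at total length [0]: there is then no edge and both
    sides vanish. *)
Lemma edge_integral_total (x : graph_point G) :
  edge_integral (len G) predT (fun e t => dist x (edge_point e t)) =
  total_length G * mean_distance_fun x.
Proof.
rewrite mean_distance_funE; have [T0|T0] := eqVneq (total_length G) 0.
  by rewrite T0 mul0r; apply: big1 => e; have := total_length_gt0 e; rewrite T0 ltxx.
by rewrite mulrA mulfV// mul1r.
Qed.

Lemma double_edge_integral_total : path_connected G ->
  double_edge_integral (len G) predT predT (@dist_kernel _ G) =
  total_length G ^+ 2 * mean_distance G.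
Proof.
move=> conn; rewrite mean_distanceE//; have [T0|T0] := eqVneq (total_length G) 0.
  by rewrite T0 expr0n mul0r; apply: big1 => e; have := total_length_gt0 e; rewrite T0 ltxx.
by rewrite mulrA exprVn mulfV ?mul1r// expf_neq0.
Qed.

(** The two mixed blocks agree by symmetry of the distance, whence the factor [2], and
    [dist_through_cut_point] evaluates them. *)
Lemma double_edge_integral_pendant (Q : pred (edge G)) (c : vertex G) :
  path_connected G ->
  (forall x y : edge G * bool,
    Q x.1 -> ~~ Q y.1 -> inc G x = inc G y -> inc G x = c) ->
  let A P := edge_integral (len G) P (fun e t => dist (inl c) (edge_point e t)) in
  let D P := double_edge_integral (len G) P P (@dist_kernel _ G) in
  D predT = D Q + D (predC Q) +
    2 * (edges_length (len G) (predC Q) * A Q +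
         edges_length (len G) Q * A (predC Q)).
Proof.
move=> conn sep A D; have dn := dist_kernel_nonexpansive conn.
have La e : lipschitz_upto (len G e) (fun t => dist (inl c) (edge_point e t)).
  by exists 1 => s t hs ht; rewrite mul1r; exact: dist_nonexpansive.
have cw e (s : R) : 0 < s < len G e -> 0 <= s <= len G e.
  by move=> /andP[/ltW-> /ltW->].
rewrite /D (double_edge_integral_split (@len_gt0 R G) dn Q); congr (_ + _).
have -> : double_edge_integral (len G) Q (predC Q) (@dist_kernel _ G) =
    edges_length (len G) (predC Q) * A Q + edges_length (len G) Q * A (predC Q).
  apply: (double_edge_integral_cross (@len_gt0 R G)) => //.
  move=> e s f t Qe Qf /cw hs /cw ht.
  exact: (dist_through_cut_point conn sep).
have -> : double_edge_integral (len G) (predC Q) Q (@dist_kernel _ G) =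
    edges_length (len G) Q * A (predC Q) + edges_length (len G) (predC Q) * A Q.
  apply: (double_edge_integral_cross (@len_gt0 R G)) => //.
  move=> e s f t Qe Qf /cw hs /cw ht; rewrite /dist_kernel dist_sym addrC.
  exact: (dist_through_cut_point conn sep).
by ring.
Qed.

End PendantDecomposition.

(** * Distances on parts of two graphs matched by opposite collapses *)

Section Retraction.
Variables (R : realType) (G G' : metric_graph R).
Variables (fv : vertex G -> vertex G') (fe : edge G -> option (edge G')).
Variables (gv : vertex G' -> vertex G) (ge : edge G' -> option (edge G)).
Hypotheses (fP : is_collapse fv fe) (gP : is_collapse gv ge).
Hypotheses (connG : path_connected G) (connG' : path_connected G').

(** Neither collapse increases distances, and they undo each other on the edges concerned, so the
    distances agree. *)
Lemma dist_edge_retract e s f t e' f' :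
  fe e = Some e' -> ge e' = Some e -> fe f = Some f' -> ge f' = Some f ->
  0 <= s <= len G e -> 0 <= t <= len G f ->
  dist_kernel e' s f' t = dist_kernel e s f t.
Proof.
move=> fee gee fef gef hs ht; apply/eqP; rewrite eq_le; apply/andP; split.
  have := dist_collapse fP (edge_point e s) (edge_point f t) connG.
  by rewrite (collapse_edge fP fee)// (collapse_edge fP fef).
have := dist_collapse gP (edge_point e' s) (edge_point f' t) connG'.
have := fP e; rewrite fee => -[le _]; have := fP f; rewrite fef => -[lf _].
by rewrite (collapse_edge gP gee) ?le// (collapse_edge gP gef) ?lf.
Qed.

Lemma dist_vertex_retract u f t u' f' :
  fv u = u' -> gv u' = u -> fe f = Some f' -> ge f' = Some f ->
  0 <= t <= len G f ->
  dist (inl u') (edge_point f' t) = dist (inl u) (edge_point f t).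
Proof.
move=> fuu guu fef gef ht; apply/eqP; rewrite eq_le; apply/andP; split.
  have := dist_collapse fP (inl u) (edge_point f t) connG.
  by rewrite (collapse_edge fP fef)//= fuu.
have := dist_collapse gP (inl u') (edge_point f' t) connG'.
have := fP f; rewrite fef => -[lf _].
by rewrite (collapse_edge gP gef) ?lf//= guu.
Qed.

End Retraction.

(** * Replacing a pendant subgraph *)

Section PendantReplacement.
Variables (R : realType) (G : metric_graph R) (H : subgraph G).
Variables (v : vertex (graph_of_subgraph H)) (Ht : metric_graph R).
Variable vt : vertex Ht.
Let GH := graph_of_subgraph H.
Let Gt := replace_subgraph H vt.

Hypotheses (connG : connected_graph G) (connGH : connected_graph GH).
Hypotheses (connHt : connected_graph Ht) (pendant : pendant_at H (val v)).

Let pG := connected_graph_path connG.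
Let pGH := connected_graph_path connGH.
Let pHt := connected_graph_path connHt.

(** The interior of the edge lies outside [H], so its ends are in the closure of the complement; an
    end in [H] is therefore in the intersection, which is [v] alone. *)
Lemma pendant_end (x : edge G * bool) :
  x.1 \notin sub_edge H -> inc G x \in sub_vertex H -> inc G x = val v.
Proof.
case: x => e b /= eH xH.
suff : [set inl (val v)]%classic (inl (inc G (e, b)) : graph_point G) by case.
rewrite -pendant; split=> //= eps eps0; have l0 := len_gt0 e.
pose r := Num.min (eps / 2) (len G e / 2).
have [r0 re rl] : [/\ 0 < r, r <= eps / 2 & r <= len G e / 2].
  by rewrite /r lt_min !ge_min !lexx orbT !divr_gt0.
exists (edge_point e (if b then len G e - r else r)).
  have [|p pE ->] := @edge_point_interior _ G e (if b then len G e - r else r).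
    by case: b {xH}; apply/andP; split; lra.
  by rewrite /= pE; exact/negP.
apply: (@le_lt_trans _ _ r); last by lra.
by apply: edge_point_near_end; apply/andP; split; lra.
Qed.

(** This gives the complement positive length, which strictness in the mean distance from [v] relies
    on. *)
Lemma pendant_complement_edge : exists e : edge G, e \notin sub_edge H.
Proof.
have [_ clv] : (subgraph_points H `&`
    metric_closure (~` subgraph_points H))%classic (inl (val v)).
  by rewrite pendant.
have [[u|p] /= /negP yH _] := clv 1 ltr01; last by exists (val p).1.
(* A vertex outside [H] differs from [v], so by connectedness an edge ends there; that edge is not
   in [H], since [H] contains the ends of its edges. *)
have /andP[_ /forallP/(_ u)/forallP/(_ (val v))/connectP[[|a q]/=]] := connG.
  by move=> _ uv; move: yH; rewrite -uv (valP v).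
move=> /andP[/existsP[e /existsP[b /andP[/eqP eu _]]] _] _.
by exists e; apply: contra yH => eH; rewrite -eu; exact: (@sub_inc _ _ H (e, b)).
Qed.

Lemma pendant_separates (x y : edge G * bool) : x.1 \in sub_edge H ->
  y.1 \notin sub_edge H -> inc G x = inc G y -> inc G x = val v.
Proof.
by move=> xH yH xy; rewrite xy pendant_end// -xy; exact: sub_inc.
Qed.

(** The default of [insubd] contracts the whole complement to [v]. *)
Definition retract_vertex (u : vertex G) : vertex GH := insubd v u.
Definition retract_edge (e : edge G) : option (edge GH) := insub e.

Lemma include_collapse :
  is_collapse (val : vertex GH -> vertex G) (fun e => Some (val e)).
Proof. by move=> e; split. Qed.

Lemma retract_collapse : is_collapse retract_vertex retract_edge.
Proof.
move=> e; rewrite /retract_edge /retract_vertex; case: insubP => [e' eH eE|eH].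
  split=> [|b]; first by rewrite /= eE.
  apply: val_inj => /=; rewrite val_insubd eE ifT//.
  exact: (@sub_inc _ _ H (e, b)).
have out b : insubd v (inc G (e, b)) = v.
  apply: val_inj; rewrite val_insubd; case: ifP => // uH.
  exact: (@pendant_end (e, b)).
by rewrite !out.
Qed.

Lemma include_replacement_collapse :
  is_collapse (inr : vertex Ht -> vertex Gt) (fun e => Some (inr e : edge Gt)).
Proof. by move=> e; split. Qed.

Definition retract_replacement_vertex (z : vertex Gt) : vertex Ht :=
  if z is inr w then w else vt.
Definition retract_replacement_edge (e : edge Gt) : option (edge Ht) :=
  if e is inr e' then Some e' else None.

Lemma retract_replacement_collapse :
  is_collapse retract_replacement_vertex retract_replacement_edge.
Proof.
case=> e /=; last by split.
by rewrite /replace_end; do 2 case: insub.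
Qed.

(** The [swap] maps contract [H] to [vt] and the [unswap] maps contract [Ht] to [v]. Both fix the
    edges outside [H], so together they show that distances there survive the replacement. *)
Definition swap_vertex (u : vertex G) : vertex Gt :=
  if insub u is Some u' then inl u' else inr vt.
Definition swap_edge (e : edge G) : option (edge Gt) := omap inl (insub e).

Lemma swap_collapse : is_collapse swap_vertex swap_edge.
Proof.
move=> e; rewrite /swap_edge /swap_vertex; case: insubP => [e' eH eE|] /=.
  by rewrite eE.
rewrite negbK => eH.
by rewrite !insubF//; apply/negbTE; rewrite negbK; exact: (@sub_inc _ _ H (e, _)).
Qed.

Definition unswap_vertex (z : vertex Gt) : vertex G :=
  match z with inl u => val u | inr _ => val v end.
Definition unswap_edge (e : edge Gt) : option (edge G) :=
  if e is inl e' then Some (val e') else None.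

(** An outside end that was reattached to [vt] was at [v] in [G], by [pendant_end]. *)
Lemma unswap_collapse : is_collapse unswap_vertex unswap_edge.
Proof.
case=> [e|e] //=; split=> // b; rewrite /replace_end.
case: insubP => [u _ <-//|]; rewrite negbK => uH /=.
by apply: (@pendant_end (val e, b)); first exact: (valP e).
Qed.

Lemma swap_vertexv : swap_vertex (val v) = inr vt.
Proof. by rewrite /swap_vertex insubF// (valP v). Qed.

Lemma swap_edgeK (e : {e | e \notin sub_edge H}) : swap_edge (val e) = Some (inl e).
Proof. by rewrite /swap_edge valK. Qed.

(** Every point is the image of a point of [G] under the swap or of a point of [Ht] under the
    inclusion, and both maps carry paths to paths. *)
Lemma path_connected_replacement : path_connected Gt.
Proof.
pose c : graph_point Gt := inl (inr vt).
have from_G x : exists L, path_length (collapse swap_vertex swap_edge x) c L.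
  have [L /(path_length_collapse swap_collapse)[L' _]] := pG x (inl (val v)).
  by rewrite /= swap_vertexv; exists L'.
have from_Ht x : exists L, path_length (@collapse _ Ht Gt inr
      (fun e => Some (inr e)) x) c L.
  have [L /(path_length_collapse include_replacement_collapse)[L' _]] :=
    pHt x (inl vt).
  by exists L'.
have to_c x : exists L, path_length x c L.
  elim/graph_pointP: x => [[u|w]|[e|e] t /andP[/ltW t0 /ltW tl]].
  - by have := from_G (inl (val u)); rewrite /= /swap_vertex valK.
  - exact: (from_Ht (inl w)).
  - have := from_G (edge_point (val e) t).
    rewrite (collapse_edge swap_collapse (swap_edgeK e))//.
    by rewrite t0.
  - have := from_Ht (edge_point e t).
    rewrite (collapse_edge include_replacement_collapse erefl)//.
    by rewrite t0.
move=> x y; have [L xL] := to_c x; have [L' yL'] := to_c y.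
by exists (L + L'); apply: path_length_trans xL (path_length_sym yL').
Qed.

(** The complement enters only through the quantities below, computed with the distance of [G]; they
    are common to the formulas before and after the replacement. *)
Let K : finType := {e | e \notin sub_edge H}.
Let lenK (e : K) := len G (val e).
Let kernelK (e : K) s (f : K) t := @dist_kernel _ G (val e) s (val f) t.
Let distK (e : K) t := dist (inl (val v)) (@edge_point _ G (val e) t).
Let massK := edges_length lenK predT.
Let momentK := edge_integral lenK predT distK.
Let energyK := double_edge_integral lenK predT predT kernelK.

Lemma closed_interval (l s : R) : 0 < s < l -> 0 <= s <= l.
Proof. by move=> /andP[/ltW-> /ltW->]. Qed.

(** The decomposition at [v], with [Q] the edges of [H]. Inclusion and retraction identify distances
    within [H] taken in [G] with the intrinsic ones. *)
Lemma mean_distance_pendant : mean_distance G =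
  (total_length GH + massK)^-1 ^+ 2 *
  (total_length GH ^+ 2 * mean_distance GH + energyK +
   2 * (massK * (total_length GH * mean_distance_fun (inl v : graph_point GH)) +
        total_length GH * momentK)).
Proof.
pose Q : pred (edge G) := mem (sub_edge H).
have Qin (e : edge G) : Q e = (e \in codom (val : edge GH -> edge G)).
  apply/idP/codomP => [eH|[e' ->]]; last exact: (valP e').
  by exists (Sub e eH).
have Qout (e : edge G) : predC Q e = (e \in codom (val : K -> edge G)).
  apply/idP/codomP => [eH|[e' ->]]; last exact: (valP e').
  by exists (Sub e eH).
have lGH (e : edge GH) : len GH e = len G (val e) by [].
have lK (e : K) : lenK e = len G (val e) by [].
have massQ : edges_length (len G) Q = total_length GH.
  exact: (edges_length_reindex val_inj Qin lGH).
have massC : edges_length (len G) (predC Q) = massK.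
  exact: (edges_length_reindex val_inj Qout lK).
have retractK (e : edge GH) : retract_edge (val e) = Some e by exact: valK.
rewrite mean_distanceE//.
have -> : total_length G = total_length GH + massK.
  by rewrite -massQ -massC /total_length (bigID Q).
congr (_ * _).
rewrite (double_edge_integral_pendant (Q := Q) (c := val v))//; last first.
  exact: pendant_separates.
rewrite massQ massC -double_edge_integral_total// -edge_integral_total.
congr (_ + _ + 2 * (_ * _ + _ * _)).
- apply: (double_edge_integral_reindex val_inj Qin lGH) => e s f t.
  move=> /closed_interval hs /closed_interval ht.
  exact: (dist_edge_retract include_collapse retract_collapse).
- exact: (double_edge_integral_reindex val_inj Qout lK).
- apply: (edge_integral_reindex val_inj Qin lGH) => e t /closed_interval ht.
  apply: (dist_vertex_retract include_collapse retract_collapse) => //.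
  exact: valKd.
- exact: (edge_integral_reindex val_inj Qout lK).
Qed.

(** The same decomposition at [vt]; the swap maps show that the terms of the complement are
    unchanged. *)
Lemma mean_distance_replacement : mean_distance Gt =
  (total_length Ht + massK)^-1 ^+ 2 *
  (total_length Ht ^+ 2 * mean_distance Ht + energyK +
   2 * (massK * (total_length Ht * mean_distance_fun (inl vt : graph_point Ht)) +
        total_length Ht * momentK)).
Proof.
have pGt := path_connected_replacement.
pose Q : pred (edge Gt) := fun e => if e is inr _ then true else false.
have Qin (e : edge Gt) : Q e = (e \in codom (inr : edge Ht -> edge Gt)).
  by apply/idP/codomP => [|[e' ->//]]; case: e => // e _; exists e.
have Qout (e : edge Gt) : predC Q e = (e \in codom (inl : K -> edge Gt)).
  by apply/idP/codomP => [|[e' ->//]]; case: e => // e _; exists e.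
have lHt (e : edge Ht) : len Ht e = len Gt (inr e) by [].
have lK (e : K) : lenK e = len Gt (inl e) by [].
have inr_inj : injective (inr : edge Ht -> edge Gt) by move=> ? ? [].
have inl_inj : injective (inl : K -> edge Gt) by move=> ? ? [].
have massQ : edges_length (len Gt) Q = total_length Ht.
  exact: (edges_length_reindex inr_inj Qin lHt).
have massC : edges_length (len Gt) (predC Q) = massK.
  exact: (edges_length_reindex inl_inj Qout lK).
rewrite mean_distanceE//.
have -> : total_length Gt = total_length Ht + massK.
  by rewrite -massQ -massC /total_length (bigID Q).
congr (_ * _).
rewrite (double_edge_integral_pendant (Q := Q) (c := inr vt))//; last first.
  (* The only vertex of [Ht] that [replace_end] can reach is [vt]. *)
  move=> [[e|e] b] [[f|f] b']//= _ _; rewrite /replace_end.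
  by case: insub => // _ [->].
rewrite massQ massC -double_edge_integral_total// -edge_integral_total.
congr (_ + _ + 2 * (_ * _ + _ * _)).
- apply: (double_edge_integral_reindex inr_inj Qin lHt) => e s f t.
  move=> /closed_interval hs /closed_interval ht.
  exact: (dist_edge_retract include_replacement_collapse
    retract_replacement_collapse).
- apply: (double_edge_integral_reindex inl_inj Qout lK) => e s f t.
  move=> /closed_interval hs /closed_interval ht.
  by apply: (dist_edge_retract swap_collapse unswap_collapse) => //;
    exact: swap_edgeK.
- apply: (edge_integral_reindex inr_inj Qin lHt) => e t /closed_interval ht.
  exact: (dist_vertex_retract include_replacement_collapse
    retract_replacement_collapse).
- apply: (edge_integral_reindex inl_inj Qout lK) => e t /closed_interval ht.
  apply: (dist_vertex_retract swap_collapse unswap_collapse) => //.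
    exact: swap_vertexv.
  exact: swap_edgeK.
Qed.

Lemma massK_gt0 : 0 < massK.
Proof.
have [e eH] := pendant_complement_edge.
rewrite /massK /edges_length (bigD1 (Sub e eH : K))//=.
rewrite ltr_pwDl ?len_gt0//; apply: sumr_ge0 => f _; exact/ltW/len_gt0.
Qed.

Hypothesis same_length : total_length GH = total_length Ht.
Hypothesis mean_v : mean_distance_fun (inl v : graph_point GH) <=
  mean_distance_fun (inl vt : graph_point Ht).
Hypothesis mean_H : mean_distance GH <= mean_distance Ht.

Lemma le_mean_distance_replacement : mean_distance G <= mean_distance Gt.
Proof.
have l0 := total_length_ge0 Ht; have k0 := ltW massK_gt0.
rewrite mean_distance_pendant mean_distance_replacement same_length.
apply: ler_wpM2l; first by rewrite exprn_ge0// invr_ge0 addr_ge0.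
by rewrite !(lerD, ler_wpM2l)// sqr_ge0.
Qed.

Lemma lt_mean_distance_replacement :
  mean_distance_fun (inl v : graph_point GH) <
    mean_distance_fun (inl vt : graph_point Ht) \/
  mean_distance GH < mean_distance Ht ->
  mean_distance G < mean_distance Gt.
Proof.
move=> strict; have k0 := massK_gt0.
(* At total length [0] all the means compared are [0], since the inverse of [0] is [0]; this
   contradicts the strict hypothesis. *)
have l0 : 0 < total_length Ht.
  rewrite lt_neqAle total_length_ge0 andbT eq_sym; apply/eqP => l0.
  move: strict; rewrite /mean_distance /mean_distance_fun same_length l0 invr0.
  by rewrite !mul0r ltxx => -[].
rewrite mean_distance_pendant mean_distance_replacement same_length.
rewrite ltr_pM2l; last by rewrite exprn_gt0// invr_gt0 addr_gt0.
(* The mean distance from [v] has the coefficient [2 * massK * total_length Ht] and the mean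
   distance [total_length Ht ^+ 2]; both are positive. *)
case: strict => strict.
  rewrite ler_ltD//; first by rewrite lerD2r ler_wpM2l// sqr_ge0.
  by rewrite ltr_pM2l// ltrD2r !ltr_pM2l.
rewrite ltr_leD//; first by rewrite ltrD2r ltr_pM2l// exprn_gt0.
by rewrite ler_pM2l// lerD2r !ler_pM2l.
Qed.

End PendantReplacement.

Theorem theorem5p1 (R : realType) (G : metric_graph R)
    (Gconn : connected_graph G) :
  (forall (v : vertex G) (P : {set {set edge G * bool}})
          (partP : finset.partition P (ends_at v)),
     connected_graph (cut_graph partP) ->
     P <> [set ends_at v]%SET ->
     mean_distance G < mean_distance (cut_graph partP))
  /\
  (forall (H : subgraph G) (v : vertex (graph_of_subgraph H))
          (Ht : metric_graph R) (vt : vertex Ht),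
     connected_graph (graph_of_subgraph H) ->
     pendant_at H (val v) ->
     connected_graph Ht ->
     total_length (graph_of_subgraph H) = total_length Ht ->
     mean_distance_fun (inl v : graph_point (graph_of_subgraph H))
       <= mean_distance_fun (inl vt : graph_point Ht) ->
     mean_distance (graph_of_subgraph H) <= mean_distance Ht ->
     mean_distance G <= mean_distance (replace_subgraph H vt)
     /\
     (mean_distance_fun (inl v : graph_point (graph_of_subgraph H))
        < mean_distance_fun (inl vt : graph_point Ht)
      \/ mean_distance (graph_of_subgraph H) < mean_distance Ht ->
      mean_distance G < mean_distance (replace_subgraph H vt))).
Proof.
split=> [v P partP Gcconn Pv|H v Ht vt connGH pend connHt lenE meanv meanH].
  exact: mean_distance_cut.
split; first exact: (le_mean_distance_replacement Gconn connGH connHt pend).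
exact: (lt_mean_distance_replacement Gconn connGH connHt pend lenE).
Qed.
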